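(* Let $\mathcal{A}$ be a unital C$^*$-algebra and let $a\in G^+$. Then, for every $u\in\mathcal{U}$, the fiber $\pi^{-1}(u)=\{g\in G:\pi(g)=u\}$ intersects $\mathcal{U}_a$ at a single point, namely $$a^{-1/2}\,\bigl(a^{1/2}\,u\,a\,u^{-1}\,a^{1/2}\bigr)^{1/2}\,a^{-1/2}\, u .$$ In other words, the restriction $\pi|_{\mathcal{U}_a}:\mathcal{U}_a\to\mathcal{U}$ is a homeomorphism.
   Context: For a unital C$^*$-algebra $\mathcal{A}$ with involution $*$: $G$ is the group of invertible elements of $\mathcal{A}$, $\mathcal{U}=\{u\in G: u^*=u^{-1}\}$ is the unitary group, and $G^+$ is the set of positive invertible elements. The subsets of $\mathcal{A}$ carry the norm topology. The map $\pi:G\to\mathcal{U}$ assigns to each $g\in G$ its unitary part in the polar decomposition: $\pi(g)=(gg^* )^{-1/2}g=g(g^*g)^{-1/2}$, i.e. $g=\lambda\,\pi(g)$ with $\lambda=(gg^* )^{1/2}\in G^+$. For $a\in G^+$, $\mathcal{U}_a=\{g\in G: a^{-1}g^*a=g^{-1}\}$ is the unitary group for the involution $x^{\#_a}=a^{-1}x^*a$. *)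

(* Defs.v *)
From HB Require Import structures.
From mathcomp Require Import all_boot all_order all_algebra complex.
From mathcomp Require Import all_classical all_reals all_analysis.

Set Implicit Arguments.
Unset Strict Implicit.
Unset Printing Implicit Defensive.

Import Order.TTheory GRing.Theory Num.Theory.
Import numFieldNormedType.Exports.

Local Open Scope classical_set_scope.
Local Open Scope complex_scope.
Local Open Scope ring_scope.

(* An HB structure joining UnitAlgebra and NormedModule is rejected, because
   numDomainType already inherits from both families.  So the algebras below
   are packed by hand and the library structures are put on their carriers.

   As for any normed module over R[i], norms take values in R[i]; the axioms
   force 0 <= `|x|, which in R[i] means real and nonnegative.  The carrier of a
   unitAlgType is a unital algebra with 1 != 0. *)
Record normedUnitAlg (R : realType) := NormedUnitAlg {
  nua_base : unitAlgType R[i];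
  nua_norm : nua_base -> R[i];
  nua_ler_normD : forall x y, nua_norm (x + y) <= nua_norm x + nua_norm y;
  nua_normrZ : forall k x, nua_norm (k *: x) = `|k| * nua_norm x;
  nua_normr0_eq0 : forall x, nua_norm x = 0 -> x = 0;
  nua_normrM_le : forall x y, nua_norm (x * y) <= nua_norm x * nua_norm y
}.

Definition nua_sort (R : realType) (A : normedUnitAlg R) : Type := nua_base A.
Coercion nua_sort : normedUnitAlg >-> Sortclass.

HB.instance Definition _ (R : realType) (A : normedUnitAlg R) :=
  GRing.UnitAlgebra.copy (nua_sort A) (nua_base A).
HB.instance Definition _ (R : realType) (A : normedUnitAlg R) :=
  Lmodule_isNormed.Build R[i] (nua_sort A)
    (@nua_ler_normD R A) (@nua_normrZ R A) (@nua_normr0_eq0 R A).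

Record cstarAlgType (R : realType) := CStarAlg {
  cstar_base : normedUnitAlg R;
  cstar_complete : forall F : set_system cstar_base,
    ProperFilter F -> cauchy F -> cvg F;
  cstar_star : cstar_base -> cstar_base;
  cstar_starK : involutive cstar_star;
  cstar_starD : {morph cstar_star : x y / x + y};
  cstar_starZ : forall k x, cstar_star (k *: x) = k^* *: cstar_star x;
  cstar_starM : forall x y, cstar_star (x * y) = cstar_star y * cstar_star x;
  cstar_norm_star : forall x, `|cstar_star x * x| = `|x| ^+ 2
}.

Definition cstar_sort (R : realType) (A : cstarAlgType R) : Type :=
  cstar_base A.
Coercion cstar_sort : cstarAlgType >-> Sortclass.

HB.instance Definition _ (R : realType) (A : cstarAlgType R) :=
  GRing.UnitAlgebra.copy (cstar_sort A) (cstar_base A).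
HB.instance Definition _ (R : realType) (A : cstarAlgType R) :=
  NormedModule.copy (cstar_sort A) (cstar_base A).
HB.instance Definition _ (R : realType) (A : cstarAlgType R) :=
  Uniform_isComplete.Build (cstar_sort A) (@cstar_complete R A).

Definition star (R : realType) (A : cstarAlgType R) (x : A) : A :=
  cstar_star x.

Definition homeomorphism_on (T U : topologicalType) (A : set T) (B : set U)
    (f : T -> U) : Prop :=
  exists g : U -> T,
    [/\ {homo f : x / A x >-> B x}, {homo g : y / B y >-> A y},
        {in A, cancel f g}, {in B, cancel g f} &
        {within A, continuous f} /\ {within B, continuous g}].

Section CStar.
Context {R : realType} {A : cstarAlgType R}.
Implicit Types (a g u x y : A).

Definition invertibles : set A := [set g | g \is a GRing.unit].

Definition spectrum x : set R[i] := [set k | k%:A - x \isn't a GRing.unit].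

Definition positive x : Prop := star x = x /\ spectrum x `<=` [set k | 0 <= k].

Definition pos_invertibles : set A := invertibles `&` positive.

(* The square root of the continuous functional calculus: the unique positive
   y with y * y = x (junk value 0 when x is not positive). *)
Definition cstar_sqrt x : A := xget 0 [set y | positive y /\ y * y = x].

Definition unitaries : set A := [set u | invertibles u /\ star u = u^-1].

Definition unitary_part g : A := (cstar_sqrt (g * star g))^-1 * g.

Definition unitaries_for a : set A :=
  [set g | invertibles g /\ a^-1 * star g * a = g^-1].

Definition unitary_fiber u : set A :=
  [set g | invertibles g /\ unitary_part g = u].

End CStar.

(* Main.v *)
Require Import Defs.
From HB Require Import structures.
From mathcomp Require Import all_boot all_order all_algebra complex.
From mathcomp Require Import all_classical all_reals all_analysis.
From mathcomp Require Import ring lra zify.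
Import Order.TTheory GRing.Theory Num.Theory.
Import numFieldNormedType.Exports.
Local Open Scope classical_set_scope.
Local Open Scope ring_scope.

(** Write q for the square root of a.  An element of the fiber over u is g = s u
    with s = (g g^* )^(1/2) positive and invertible, and g lies in the unitary
    group of a exactly when s a s = u a u^-1 (polar_unitaries_for).  Multiplying
    by q on both sides turns this equation into
      (q s q)^2 = q u a u^-1 q,
    so q s q must be the positive square root of the right-hand side, which
    determines s; conversely this s is positive and solves the equation
    (twisted_modulusE).  Both g |-> pi(g) and u |-> s u are built from products,
    adjoints, inverses and square roots of positive invertible elements, and all
    of these are continuous.

    What remains is the theory of square roots of positive invertible elements,
    developed here from the C^*-axioms and completeness, with no appeal to the
    Gelfand transform or to the spectral radius formula.

    - A self-adjoint x has its norm or minus its norm in its spectrum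
      (norm_in_spectrum).  The engine is the inequality |p|^2 <= |p^2 + q^2| for
      commuting self-adjoint p, q, read off from p = Re (p + iq).  If |x| = 1 it
      makes the sums 1 + x^2 + ... + x^(2(N-1)), N = 2^m, have norm at least N,
      whereas (1 - x^2) times such a sum is 1 - x^(2N), of norm at most 2; so
      1 - x^2 cannot be invertible.

    - Hence order can be read off from norms: x >= d in the spectral sense
      amounts to |t - x| <= t - d for some real t (above).  In this form the sum
      of positive elements is visibly positive.

    - Square roots come from the contraction z |-> (x + z^2)/2.  For positive r
      and s >= d > 0 the Sylvester operator y |-> r y + y s is bounded below by d
      (above_sylvester).  Applied to r^2 - s^2 = r (r - s) + (r - s) s it gives
      at once uniqueness and local Lipschitz continuity of the square root, and
      applied to a commutator it shows that the square root of x commutes with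
      everything commuting with x.

    - g g^* is positive for invertible g (mul_star_pos_invertibles): with
      x = g g^*, m = |x| and c = (m - x) g one has - c c^* = ((m - x) m^(1/2))^2,
      which is positive, and this forces c = 0, that is x = m. *)

(** * The norm as a real number, and the involution *)

Section Norm.
Context {R : realType} {A : cstarAlgType R}.
Implicit Types (x y z p q : A) (k : R[i]) (t : R).

(** The norm of the algebra takes values in R[i], where the order is partial;
    estimates are carried out on its real part. *)
Definition rnorm x : R := complex.Re `|x|.

Lemma rnormE x : `|x| = (rnorm x)%:C%C.
Proof. by rewrite RRe_real // realE normr_ge0. Qed.

Lemma rnorm_ge0 x : 0 <= rnorm x.
Proof. by rewrite -lecR -rnormE normr_ge0. Qed.

Lemma rnorm0 : rnorm 0 = 0.
Proof. by rewrite /rnorm normr0. Qed.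

Lemma rnorm_eq0 x : (rnorm x == 0) = (x == 0).
Proof. by rewrite -(normr_eq0 x) rnormE (inj_eq (@complexI _) _ 0). Qed.

Lemma rnormN x : rnorm (- x) = rnorm x.
Proof. by rewrite /rnorm normrN. Qed.

Lemma rnormBC x y : rnorm (x - y) = rnorm (y - x).
Proof. by rewrite -opprB rnormN. Qed.

Lemma rnormD x y : rnorm (x + y) <= rnorm x + rnorm y.
Proof. by rewrite -lecR rmorphD /= -!rnormE ler_normD. Qed.

Lemma rnormB x y : rnorm (x - y) <= rnorm x + rnorm y.
Proof. by rewrite -(rnormN y) rnormD. Qed.

Lemma rnormM x y : rnorm (x * y) <= rnorm x * rnorm y.
Proof. by rewrite -lecR rmorphM /= -!rnormE; exact: nua_normrM_le. Qed.

Lemma rnormZ k x : rnorm (k *: x) = complex.Re `|k| * rnorm x.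
Proof.
apply: (@complexI R); rewrite -rnormE normrZ rnormE -[`|k| in LHS]RRe_real.
  exact/esym/rmorphM.
exact: normr_real.
Qed.

Lemma rnormrZ t x : rnorm (t%:C%C *: x) = `|t| * rnorm x.
Proof. by rewrite rnormZ normc_def /= expr0n addr0 sqrtr_sqr. Qed.

Lemma rnorm_starM x : rnorm (star x * x) = rnorm x ^+ 2.
Proof.
apply/(@complexI R); rewrite rmorphXn /= -!rnormE.
exact: (cstar_norm_star x).
Qed.

Lemma starK x : star (star x) = x. Proof. exact: cstar_starK. Qed.

Lemma starM x y : star (x * y) = star y * star x.
Proof. exact: cstar_starM. Qed.

Lemma starD x y : star (x + y) = star x + star y.
Proof. exact: cstar_starD. Qed.

Lemma starZ k x : star (k *: x) = Num.conj k *: star x.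
Proof. exact: cstar_starZ. Qed.

Lemma starN x : star (- x) = - star x.
Proof. by rewrite -scaleN1r starZ rmorphN rmorph1 scaleN1r. Qed.

Lemma starB x y : star (x - y) = star x - star y.
Proof. by rewrite starD starN. Qed.

Lemma star0 : star (0 : A) = 0.
Proof. by rewrite -(scale0r (0 : A)) starZ rmorph0 !scale0r. Qed.

Lemma star1 : star (1 : A) = 1.
Proof.
have h : star (star 1 * 1) = star 1 * star (star 1) :> A by rewrite starM.
by rewrite mulr1 !starK mulr1 in h; rewrite -h.
Qed.

Lemma conjrc t : Num.conj t%:C%C = t%:C%C.
Proof. by rewrite conj_Creal // complex_real. Qed.

Lemma starrZ t x : star (t%:C%C *: x) = t%:C%C *: star x.
Proof. by rewrite starZ conjrc. Qed.

Lemma starX x n : star (x ^+ n) = star x ^+ n.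
Proof.
elim: n => [|n IHn]; first by rewrite !expr0 star1.
by rewrite exprS exprSr starM IHn.
Qed.

Lemma star_unit x : (star x \is a GRing.unit) = (x \is a GRing.unit).
Proof.
have H y : y \is a GRing.unit -> star y \is a GRing.unit.
  move=> uy; apply/unitrP; exists (star y^-1).
  by rewrite -!starM mulrV // mulVr // star1.
by apply/idP/idP => /H //; rewrite starK.
Qed.

Lemma starV x : star x^-1 = (star x)^-1.
Proof.
have [ux|nux] := boolP (x \is a GRing.unit); last first.
  by rewrite !invr_out // star_unit.
apply: (mulIr (x := star x)); first by rewrite star_unit.
by rewrite -starM mulrV // mulVr ?star_unit // star1.
Qed.

Lemma rnorm_star x : rnorm (star x) = rnorm x.
Proof.
have H y : rnorm y <= rnorm (star y).
  have [->|y0] := eqVneq y 0; first by rewrite star0.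
  have yp : 0 < rnorm y by rewrite lt_neqAle eq_sym rnorm_eq0 y0 rnorm_ge0.
  by rewrite -(ler_pM2r yp) -expr2 -rnorm_starM rnormM.
by apply/eqP; rewrite eq_le H andbT -{2}[x]starK H.
Qed.

Lemma rnorm1 : rnorm 1 = 1.
Proof.
have /eqP := rnorm_starM 1.
rewrite star1 mul1r -subr_eq0 expr2 -{1}(mulr1 (rnorm 1)).
rewrite -mulrBr mulf_eq0 rnorm_eq0 oner_eq0 /= subr_eq0 => /eqP <- //.
Qed.

Lemma rnormC t : rnorm (t%:C%C%:A) = `|t|.
Proof. by rewrite rnormrZ rnorm1 mulr1. Qed.

Lemma rnorm_sqr x : star x = x -> rnorm (x * x) = rnorm x ^+ 2.
Proof. by move=> xs; rewrite -rnorm_starM xs. Qed.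

(** With w = p + iq the sum of squares is w^* w, of norm |w|^2, while
    p = (w + w^* )/2 has norm at most |w|. *)
Lemma rnorm_sum_squares p q : star p = p -> star q = q -> p * q = q * p ->
  rnorm p ^+ 2 <= rnorm (p * p + q * q).
Proof.
move=> ps qs pq; set w := p + 'i *: q.
have ws : star w = p - 'i *: q by rewrite starD starZ conjCi ps qs scaleNr.
have <- : star w * w = p * p + q * q.
  have pr : p * ('i *: q) = 'i *: q * p by rewrite -scalerAr -scalerAl pq.
  have rr : 'i *: q * ('i *: q) = - (q * q).
    by rewrite -scalerAr -scalerAl scalerA -expr2 sqrCi scaleN1r.
  by rewrite ws mulrDr !mulrBl pr rr opprK addrA subrK.
rewrite rnorm_starM lerXn2r ?nnegrE ?rnorm_ge0 //.
have : rnorm (w + star w) <= rnorm w + rnorm w.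
  by rewrite (le_trans (rnormD _ _)) // rnorm_star.
rewrite ws addrACA subrr addr0.
have -> : p + p = (2 : R)%:C%C *: p by rewrite rmorph_nat scaler_nat mulr2n.
rewrite rnormrZ ger0_norm //; lra.
Qed.

Lemma star_commM x y : star x = x -> star y = y -> x * y = y * x ->
  star (x * y) = x * y.
Proof. by move=> xs ys xy; rewrite starM xs ys xy. Qed.

(** Comes from (1 + x^2)^2 = (1 - x^2)^2 + (2x)^2: dropping the first square
    cannot increase the norm.  The factor v allows the bound to be iterated
    along a product. *)
Lemma rnorm_amgm (v x : A) : star v = v -> star x = x -> v * x = x * v ->
  2 * rnorm (v * x) <= rnorm (v * (1 + x * x)).
Proof.
move=> vs xs vx.
have ys : star (x * x) = x * x by exact: star_commM.
have vy : GRing.comm v (x * x) by exact: commrM.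
have xy : GRing.comm x (x * x) by exact: commrM.
have EM y z : GRing.comm v y -> v * y * (v * z) = v * v * (y * z).
  by move=> vy'; rewrite -!mulrA [y * (v * z)]mulrA -vy' !mulrA.
have v1y : GRing.comm v (1 + x * x) by apply: commrD => //; exact: commr1.
have v1y' : GRing.comm v (1 - x * x) by apply: commrB => //; exact: commr1.
have x1y' : GRing.comm x (1 - x * x) by apply: commrB => //; exact: commr1.
have s1 : star (v * (1 + x * x)) = v * (1 + x * x).
  by apply: star_commM => //; rewrite starD star1 ys.
pose p := (2 : R)%:C%C *: (v * x); pose q := v * (1 - x * x).
have ps : star p = p by rewrite /p starrZ star_commM.
have qs : star q = q.
  by apply: star_commM => //; rewrite starB star1 ys.
have pq : p * q = q * p.
  by rewrite /p /q -scalerAl -scalerAr !EM // x1y'.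
have e : p * p + q * q = v * (1 + x * x) * (v * (1 + x * x)).
  rewrite /p /q -scalerAl -scalerAr scalerA !EM //.
  have -> : (2 : R)%:C%C * (2 : R)%:C%C = 4%:R.
    by rewrite rmorph_nat -natrM.
  rewrite scalerAr -mulrDr; congr (_ * _).
  set y := x * x.
  rewrite -!expr2 [1 + y]addrC sqrrD1 -sqrrN opprB sqrrB1 scaler_nat.
  by rewrite addrC (mulrnDr y 2 2) addrAC addrA subrK.
have := rnorm_sum_squares _ _ ps qs pq.
rewrite e (rnorm_sqr _ s1).
rewrite ler_pXn2r ?nnegrE ?rnorm_ge0 //.
rewrite rnormrZ ger0_norm //.
Qed.

End Norm.

(** * The norm of a self-adjoint element is attained on its spectrum *)

Section Spectrum.
Context {R : realType} {A : cstarAlgType R}.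
Implicit Types (x y z p q : A) (k : R[i]) (t : R).

(** The geometric sum of the x^(2j) for j < 2^m, factored as the product of the
    1 + x^(2^(j+1)) for j < m so that rnorm_amgm applies factor by factor. *)
Fixpoint geom_squares m x : A :=
  if m is m'.+1 then (1 + x * x) * geom_squares m' (x * x) else 1.

Lemma geom_squaresE m x :
  (1 - x * x) * geom_squares m x = 1 - x ^+ (2 ^ m.+1).
Proof.
elim: m x => [|m IHm] x; first by rewrite mulr1 -expr2.
rewrite /= mulrA mulrBl mul1r mulrDr mulr1 opprD addrA addrK IHm.
by rewrite -expr2 -exprM -expnS.
Qed.

(** Each factor 1 + y^2 costs a factor 2 and leaves a y behind, where y runs
    through the powers x^(2^j); the exponents add up to 2^m - 1. *)
Lemma geom_squares_ge m x v : star x = x -> star v = v -> x * v = v * x ->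
  2 ^+ m * rnorm (v * x ^+ (2 ^ m).-1) <= rnorm (v * geom_squares m x).
Proof.
elim: m x v => [|m IHm] x v xs vs xv; first by rewrite expr0 mul1r /= expr0.
have xxs : star (x * x) = x * x by exact: star_commM.
have vxx : GRing.comm v (x * x) by exact: commrM.
have w1 : GRing.comm v (1 + x * x) by apply: commrD => //; exact: commr1.
have ws : star (v * (1 + x * x)) = v * (1 + x * x).
  by apply: star_commM => //; rewrite starD star1 xxs.
have c1 : GRing.comm (x * x) (1 + x * x).
  by apply: commrD; [exact: commr1|].
have cw : x * x * (v * (1 + x * x)) = v * (1 + x * x) * (x * x).
  by apply: commrM => //; exact/commr_sym.
rewrite /= mulrA; apply: le_trans (IHm _ _ xxs ws cw).
rewrite exprSr -mulrA ler_wpM2l ?exprn_ge0 //.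
set n := (2 ^ m).-1.
have -> : (2 ^ m.+1).-1 = (n * 2).+1.
  have : (0 < 2 ^ m)%N by rewrite expn_gt0.
  by rewrite expnS /n; case: (2 ^ m)%N => // l _ /=; rewrite mulnC !mulnS; lia.
have -> : (x * x) ^+ n = x ^+ (n * 2) by rewrite mulnC exprM expr2.
have cn : GRing.comm (x ^+ (n * 2)) (1 + x * x).
  by apply: commrD; [exact: commr1|apply: commrM; exact/commr_sym/commrX].
rewrite -mulrA -cn mulrA exprSr mulrA.
have cvx : GRing.comm v (x ^+ (n * 2)) by apply: commrX; exact/esym.
apply: rnorm_amgm => //.
  by apply: star_commM => //; rewrite starX xs.
by apply/commr_sym/commrM; [exact: xv|apply: commrX].
Qed.

(** An inverse of 1 - x^2 would bound the geometric sums by twice its norm, but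
    their norms are at least 2^m. *)
Lemma one_sub_sqr_nonunit x : star x = x -> rnorm x = 1 ->
  1 - x * x \isn't a GRing.unit.
Proof.
move=> xs x1; apply/negP => ux.
have x2 m : rnorm (x ^+ (2 ^ m)) = 1.
  elim: m => [|m IHm]; first by rewrite expr1.
  by rewrite expnS mulnC exprM expr2 rnorm_sqr ?starX ?xs // IHm expr1n.
have xp m : 1 <= rnorm (x ^+ (2 ^ m).-1).
  have := rnormM x (x ^+ (2 ^ m).-1).
  by rewrite -exprS prednK ?expn_gt0 // x2 x1 mul1r.
have bd m : 2 ^+ m <= rnorm (1 - x * x)^-1 * 2.
  apply: (@le_trans _ _ (rnorm (geom_squares m x))).
    have := @geom_squares_ge m x 1 xs star1 (commr1 _); rewrite !mul1r.
    by apply: le_trans; rewrite ler_peMr // exprn_ge0.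
  rewrite -[geom_squares m x](mulKr ux) geom_squaresE.
  rewrite (le_trans (rnormM _ _)) // ler_wpM2l ?rnorm_ge0 //.
  by rewrite (le_trans (rnormB _ _)) // rnorm1 x2.
set M := rnorm (1 - x * x)^-1 * 2 in bd.
have [n Mn] : exists n : nat, M < n%:R.
  exists (Num.trunc M).+1; exact: truncnS_gt.
have := le_trans (bd n) (ltW Mn).
rewrite -natrX ler_nat leqNgt ltn_expl //.
Qed.
End Spectrum.

(** * Completeness: fixed points and the Neumann series *)

Section FixedPoint.
Context {R : realType} {A : cstarAlgType R}.
Implicit Types (x y z p q : A) (k : R[i]) (t : R).

Lemma cvg_rnorm (T : Type) (F : set_system T) (f : T -> A) (l : A) :
  Filter F -> (f x @[x --> F] --> l) <-> (rnorm (l - f x) @[x --> F] --> (0 : R)).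
Proof.
move=> FF; split=> [/cvgrPdist_lt fl|/cvgrPdist_lt fl]; apply/cvgrPdist_lt => e e0.
  have e0' : 0 < e%:C%C by rewrite ltcR.
  apply: filterS (fl _ e0') => x; rewrite rnormE ltcR.
  by rewrite sub0r normrN ger0_norm ?rnorm_ge0.
have e0' : 0 < complex.Re e by move: e0; rewrite ltcE => /andP[].
have -> : e = (complex.Re e)%:C%C by rewrite RRe_real // realE ltW.
apply: filterS (fl _ e0') => x; rewrite rnormE ltcR.
by rewrite sub0r normrN ger0_norm ?rnorm_ge0.
Qed.

Lemma cvg_geometric_steps (u : nat -> A) (c q : R) : 0 <= q < 1 ->
  (forall n, rnorm (u n.+1 - u n) <= c * q ^+ n) ->
  exists l : A, u n @[n --> \oo] --> l.
Proof.
move=> /andP[q0 q1] uS.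
have c0 : 0 <= c by have := uS 0%N; rewrite expr0 mulr1; exact/le_trans/rnorm_ge0.
have q1' : 0 < 1 - q by rewrite subr_gt0.
have ud n m : rnorm (u n - u (n + m)%N) <= c / (1 - q) * q ^+ n * (1 - q ^+ m).
  elim: m => [|m IHm]; first by rewrite addn0 subrr rnorm0 expr0 subrr mulr0.
  rewrite addnS -(subrKA (u (n + m)%N)) (le_trans (rnormD _ _)) //.
  rewrite [in X in _ + X]rnormBC (le_trans (lerD IHm (uS _))) //.
  rewrite le_eqVlt; apply/orP; left; apply/eqP.
  by rewrite exprD exprSr; field; exact: lt0r_neq0.
suff : cvg (u n @[n --> \oo]) by move=> uc; exists (lim (u n @[n --> \oo])).
apply/cauchy_cvgP.
apply: cauchy_exP => e e0.
have e0' : 0 < complex.Re e by move: e0; rewrite ltcE => /andP[].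
have /cvgrPdist_lt/(_ _ e0')[n _ /(_ n (leqnn n))] :
    geometric (c / (1 - q)) q @ \oo --> (0 : R).
  by apply: cvg_geometric; rewrite ger0_norm.
rewrite /= sub0r normrN ger0_norm; last first.
  by rewrite !mulr_ge0 ?invr_ge0 ?exprn_ge0 // ltW.
move=> he; exists (u n); exists n => // m /= nm.
rewrite -ball_normE /= rnormE -[e]RRe_real ?realE ?(ltW e0) // ltcR.
apply: le_lt_trans he; rewrite -(subnKC nm) (le_trans (ud _ _)) //.
rewrite ler_piMr ?lerBlDr ?lerDl ?exprn_ge0 //.
by rewrite !mulr_ge0 ?invr_ge0 ?exprn_ge0 // ltW.
Qed.

Lemma contraction_fixed_point (f : A -> A) (r q : R) : 0 <= q < 1 -> 0 <= r ->
  (forall z, rnorm z <= r -> rnorm (f z) <= r) ->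
  (forall y z, rnorm y <= r -> rnorm z <= r ->
    rnorm (f y - f z) <= q * rnorm (y - z)) ->
  exists2 z, rnorm z <= r & f z = z.
Proof.
move=> q01 r0 fr fq; pose u n := iter n f 0.
have ur n : rnorm (u n) <= r by elim: n => [|n]; rewrite ?rnorm0 //; exact: fr.
have uS n : rnorm (u n.+1 - u n) <= r * q ^+ n.
  elim: n => [|n IHn]; first by rewrite expr0 mulr1 subr0 ur.
  apply: le_trans (fq _ _ (ur n.+1) (ur n)) _; rewrite exprS mulrCA.
  by rewrite ler_wpM2l //; case/andP: q01.
have [l /cvg_rnorm ul] := cvg_geometric_steps _ _ _ q01 uS.
have close e : 0 < e -> exists n, rnorm (l - u n) < e /\ rnorm (l - u n.+1) < e.
  move=> e0; move/cvgrPdist_lt : ul => /(_ _ e0)[n _ nP].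
  exists n; have := nP _ (leqnn n); have := nP _ (leqnSn n).
  by rewrite /= !sub0r !normrN !ger0_norm ?rnorm_ge0.
have lr : rnorm l <= r.
  apply/ler_addgt0Pr => e e0; have [n [ne _]] := close e e0.
  rewrite -(subrK (u n) l) (le_trans (rnormD _ _)) //.
  by rewrite addrC lerD // ltW.
exists l => //; apply/eqP; rewrite -subr_eq0 -rnorm_eq0 eq_le rnorm_ge0 andbT.
apply/ler_addgt0Pr => e e0; rewrite add0r.
have [n [ne nSe]] := close _ (divr_gt0 e0 (ltr0n _ 2)).
rewrite -(subrKA (u n.+1)) (le_trans (rnormD _ _)) //.
rewrite [e]splitr lerD //; last by rewrite rnormBC ltW.
apply: le_trans (fq _ _ lr (ur n)) _; apply: le_trans (ltW ne).
by rewrite ler_piMl ?rnorm_ge0 // ltW; case/andP: q01.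
Qed.

(** The fixed points of z |-> 1 + x z and of z |-> 1 + z x are a right and a left
    inverse of 1 - x. *)
Lemma neumann x : rnorm x < 1 -> 1 - x \is a GRing.unit.
Proof.
move=> x1; have x01 : 0 <= rnorm x < 1 by rewrite rnorm_ge0.
have x1' : 0 < 1 - rnorm x by rewrite subr_gt0.
(* The ball of this radius is stable because 1 + |x| r = r. *)
pose r := 1 / (1 - rnorm x).
have r0 : 0 <= r by rewrite divr_ge0 // ltW.
have fr y z : rnorm y <= rnorm x * rnorm z -> rnorm z <= r -> rnorm (1 + y) <= r.
  move=> yz zr; rewrite (le_trans (rnormD _ _)) // rnorm1.
  have -> : r = 1 + rnorm x * r by rewrite /r; field; exact: lt0r_neq0.
  rewrite lerD2l (le_trans yz) // ler_wpM2l ?rnorm_ge0 //.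
have [|y z _ _|y _ yE] := @contraction_fixed_point (fun z => 1 + x * z) r _ x01 r0.
- by move=> z; apply: fr; exact: rnormM.
- by rewrite opprD addrACA subrr add0r -mulrBr rnormM.
have [|z w _ _|z _ zE] := @contraction_fixed_point (fun z => 1 + z * x) r _ x01 r0.
- by move=> z; apply: fr; rewrite mulrC rnormM.
- by rewrite opprD addrACA subrr add0r -mulrBl mulrC rnormM.
have y1 : (1 - x) * y = 1 by rewrite mulrBl mul1r -{1}yE addrK.
have z1 : z * (1 - x) = 1 by rewrite mulrBr mulr1 -{1}zE addrK.
have yz : y = z by rewrite -[y]mul1r -z1 -mulrA y1 mulr1.
by apply/unitrP; exists y; rewrite y1 {1}yz z1.
Qed.

End FixedPoint.

(** * Spectrum and order *)

Section Order.
Context {R : realType} {A : cstarAlgType R}.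
Implicit Types (x y z p q r s : A) (k c : R[i]) (t d : R).

Lemma spectrum_shift x c k : spectrum (x + c%:A) (k + c) = spectrum x k.
Proof. by rewrite /spectrum /= scalerDl opprD addrACA subrr addr0. Qed.

Lemma spectrum_reflect x c k : spectrum (c%:A - x) (c - k) = spectrum x k.
Proof.
rewrite /spectrum /= scalerBl.
have -> : c%:A - k%:A - (c%:A - x) = - (k%:A - x).
  by rewrite opprB addrC subrKA opprB.
by rewrite unitrN.
Qed.

Lemma spectrum_scale x c k : c != 0 -> spectrum (c *: x) (c * k) = spectrum x k.
Proof.
by move=> c0; rewrite /spectrum /= -scalerA -scalerBr scaler_unit // unitfE.
Qed.

Lemma spectrum_norm_le x k : spectrum x k -> complex.Re `|k| <= rnorm x.
Proof.
apply: contraPT; rewrite -ltNge => xk /=; apply/negP; rewrite negbK.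
have k0 : k != 0.
  by apply: contraTneq xk => ->; rewrite normr0 -leNgt rnorm_ge0.
have -> : k%:A - x = k *: (1 - k^-1 *: x).
  by rewrite scalerBr scalerA divff // scale1r.
rewrite scaler_unit ?unitfE //; apply: neumann; rewrite rnormZ.
have kp : 0 < complex.Re `|k| by rewrite (le_lt_trans _ xk) ?rnorm_ge0.
have -> : complex.Re `|k^-1| = (complex.Re `|k|)^-1.
  apply: (@complexI R); rewrite fmorphV RRe_real ?normr_real //.
  by rewrite normfV; congr (_ ^-1); apply/esym/RRe_real/normr_real.
by rewrite mulrC ltr_pdivrMr // mul1r.
Qed.

Lemma Re_norm_sqr k :
  complex.Re `|k| ^+ 2 = complex.Re k ^+ 2 + complex.Im k ^+ 2.
Proof. by rewrite normc_def /= sqr_sqrtr // addr_ge0 ?sqr_ge0. Qed.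

(** If a + ib is in the spectrum of x, then a + i(b + l) is in the spectrum of
    x + il, so a^2 + (b + l)^2 <= |x + il|^2 <= |x|^2 + l^2 for every real l.
    This is affine in l with slope 2b, hence b = 0. *)
Lemma spectrum_sa_real x k : star x = x -> spectrum x k -> complex.Im k = 0.
Proof.
move=> xs; case: k => a b /= kx; apply/eqP/negP => /negP b0.
(* Chosen so that 2 b l exceeds |x|^2. *)
pose l : R := (rnorm x ^+ 2 + 1) / (2 * b).
pose c : R[i] := (0 +i* l)%C.
have := @spectrum_norm_le (x + c%:A) ((a +i* b)%C + c).
rewrite spectrum_shift => /(_ kx) le1.
have cc : Num.conj c = - c by apply/eqP; rewrite eq_complex /= oppr0 !eqxx.
have : rnorm (x + c%:A) ^+ 2 <= rnorm x ^+ 2 + l ^+ 2.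
  rewrite -rnorm_starM starD starZ star1 xs cc.
  have -> : (x + (- c) *: 1) * (x + c%:A) = x * x + (l ^+ 2)%:C%C *: 1.
    rewrite scaleNr mulrDr !mulrBl -!scalerAl -!scalerAr !mul1r !mulr1 scalerA.
    rewrite addrA subrK; congr (_ + _); rewrite -scaleNr; congr (_ *: _).
    apply/eqP; rewrite eq_complex /= !mul0r !mulr0 !addr0 sub0r oppr0 opprK eqxx.
    by rewrite eqxx.
  rewrite (le_trans (rnormD _ _)) // rnormC ger0_norm ?sqr_ge0 //.
  by rewrite lerD2r expr2 rnormM.
apply/negP; rewrite -ltNge.
apply: (@lt_le_trans _ _ (a ^+ 2 + (b + l) ^+ 2)).
  have : 2 * (b * l) = rnorm x ^+ 2 + 1 by rewrite /l; field.
  rewrite sqrrD => e; have := sqr_ge0 a; have := sqr_ge0 b; lra.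
have <- : complex.Re `|(a +i* b)%C + c| ^+ 2 = a ^+ 2 + (b + l) ^+ 2.
  by rewrite Re_norm_sqr /= addr0.
have := normr_ge0 ((a +i* b)%C + c); rewrite lecE => /andP[_ /= ?].
by rewrite lerXn2r ?nnegrE ?rnorm_ge0.
Qed.

Lemma norm_in_spectrum x : star x = x ->
  exists2 t, `|t| = rnorm x & spectrum x t%:C%C.
Proof.
move=> xs; have [->|x0] := eqVneq x 0.
  exists 0; first by rewrite normr0 rnorm0.
  by rewrite /spectrum /= scale0r subrr unitr0.
set n := rnorm x; have n0 : 0 < n by rewrite lt_neqAle eq_sym rnorm_eq0 x0 rnorm_ge0.
have nC0 : n%:C%C != 0 by rewrite (inj_eq (@complexI _) _ 0) gt_eqF.
pose y := n^-1%:C%C *: x.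
have ys : star y = y by rewrite starrZ xs.
have y1 : rnorm y = 1.
  by rewrite rnormrZ ger0_norm ?invr_ge0 ?(ltW n0) // mulVf // gt_eqF.
have xE : x = n%:C%C *: y by rewrite scalerA -rmorphM /= divff ?scale1r // gt_eqF.
have := one_sub_sqr_nonunit _ ys y1.
have -> : 1 - y * y = (1 - y) * (1 + y).
  by rewrite mulrBl mul1r mulrDr mulr1 opprD addrA addrK.
have [u1|nu1 _] := boolP (1 - y \is a GRing.unit); last first.
  exists n; first by rewrite gtr0_norm.
  by rewrite -[n%:C%C]mulr1 {1}xE spectrum_scale // /spectrum /= scale1r.
rewrite unitrMr // => nu2; exists (- n); first by rewrite normrN gtr0_norm.
have -> : (- n)%:C%C = n%:C%C * (- 1) by rewrite rmorphN mulrN1.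
rewrite {1}xE spectrum_scale // /spectrum /=.
by rewrite scaleN1r -opprD unitrN.
Qed.

(** The inequality d <= x for self-adjoint x: the spectrum of t - x is then
    contained in [-(t - d), t - d] as soon as t is large, and the norm of t - x
    detects this. *)
Definition above d x := star x = x /\ exists t, rnorm (t%:C%C%:A - x) <= t - d.

Lemma star_realC t : star (t%:C%C%:A : A) = t%:C%C%:A.
Proof. by rewrite starrZ star1. Qed.

Lemma spectrum_real_le x t : spectrum x t%:C%C -> `|t| <= rnorm x.
Proof. by move=> /spectrum_norm_le; rewrite normc_def /= expr0n addr0 sqrtr_sqr. Qed.

Lemma positive_above0 x : positive x -> above 0 x.
Proof.
move=> [xs xp]; split => //; exists (rnorm x); rewrite subr0.
have [|t <-] := norm_in_spectrum ((rnorm x)%:C%C%:A - x).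
  by rewrite starB star_realC xs.
have -> : t%:C%C = (rnorm x)%:C%C - ((rnorm x - t)%:C%C).
  by rewrite -rmorphB /= subKr.
rewrite spectrum_reflect => sx; have := spectrum_real_le _ _ sx.
have /= := xp _ sx; rewrite lecR => ?; rewrite ger0_norm // => ?.
by rewrite ler_norml; lra.
Qed.

Lemma above_positive d x : 0 <= d -> above d x -> positive x.
Proof.
move=> d0 [xs [t xt]]; split=> // k kx /=.
have : complex.Im k = 0 by exact: spectrum_sa_real kx.
case: k kx => s b /= kx b0; rewrite {b}b0 in kx *; rewrite lecE /= eqxx /=.
have : spectrum (t%:C%C%:A - x) (t - s)%:C%C.
  by rewrite rmorphB spectrum_reflect.
move=> /spectrum_real_le /le_trans/(_ xt); rewrite ler_norml; lra.
Qed.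

Lemma above_unit d x : 0 < d -> above d x -> x \is a GRing.unit.
Proof.
move=> d0 [_ [t xt]]; apply/negPn/negP => nx.
have : spectrum (t%:C%C%:A - x) t%:C%C.
  by rewrite -[X in spectrum _ X]subr0 spectrum_reflect /spectrum /= scale0r sub0r unitrN.
move=> /spectrum_real_le /le_trans/(_ xt); rewrite ler_norml; lra.
Qed.

Lemma pos_invertibles_above x : pos_invertibles x -> exists2 d, 0 < d & above d x.
Proof.
move=> [ux [xs xp]].
have [|t tE] := norm_in_spectrum ((rnorm x)%:C%C%:A - x).
  by rewrite starB star_realC xs.
have -> : t%:C%C = (rnorm x)%:C%C - ((rnorm x - t)%:C%C).
  by rewrite -rmorphB /= subKr.
rewrite spectrum_reflect => sx; have := spectrum_real_le _ _ sx.
have /= := xp _ sx; rewrite lecR => h1; rewrite ger0_norm // => h2.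
have h3 : rnorm x - t != 0.
  by apply: contraPneq sx => ->; rewrite /spectrum /= scale0r sub0r unitrN ux.
have h4 : 0 < rnorm x - t by rewrite lt_neqAle eq_sym h3.
exists (rnorm x - t) => //; split => //; exists (rnorm x).
by rewrite -tE subKr ger0_norm //; lra.
Qed.

(** Writing r = t1 - r' and s = t2 - s', with |r'| <= t1 - d1 and
    |s'| <= t2 - d2, the operator y |-> r y + y s is t1 + t2 minus an operator of
    norm at most t1 + t2 - d1 - d2.  No commutation is involved. *)
Lemma above_sylvester d1 d2 r s y : above d1 r -> above d2 s ->
  (d1 + d2) * rnorm y <= rnorm (r * y + y * s).
Proof.
move=> [_ [t1 h1]] [_ [t2 h2]].
have e : (t1 + t2)%:C%C *: y =
    (r * y + y * s) + ((t1%:C%C%:A - r) * y + y * (t2%:C%C%:A - s)).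
  rewrite mulrBl mulrBr mulr_algl mulr_algr addrACA !subrKC.
  by rewrite rmorphD /= scalerDl.
have [->|y0] := eqVneq y 0; first by rewrite rnorm0 mulr0 rnorm_ge0.
have := congr1 rnorm e; rewrite rnormrZ => e'.
have : (t1 + t2) * rnorm y <= rnorm (r * y + y * s) +
    ((t1 - d1) * rnorm y + rnorm y * (t2 - d2)).
  apply: (@le_trans _ _ (`|t1 + t2| * rnorm y)).
    by rewrite ler_wpM2r ?rnorm_ge0 // ler_norm.
  rewrite e' (le_trans (rnormD _ _)) // lerD2l (le_trans (rnormD _ _)) // lerD //.
    by rewrite (le_trans (rnormM _ _)) // ler_wpM2r ?rnorm_ge0.
  by rewrite (le_trans (rnormM _ _)) // ler_wpM2l ?rnorm_ge0.
lra.
Qed.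

Lemma aboveD d1 d2 x y : above d1 x -> above d2 y -> above (d1 + d2) (x + y).
Proof.
move=> [xs [t1 h1]] [ys [t2 h2]]; split; first by rewrite starD xs ys.
exists (t1 + t2); rewrite rmorphD /= scalerDl opprD addrACA.
rewrite (le_trans (rnormD _ _)) // (le_trans (lerD h1 h2)) //; lra.
Qed.

Lemma positiveD x y : positive x -> positive y -> positive (x + y).
Proof.
move=> /positive_above0 x0 /positive_above0 y0.
by apply: (@above_positive (0 + 0)); [rewrite addr0|exact: aboveD].
Qed.

End Order.

(** * Square roots of positive invertible elements *)

Section SquareRoot.
Context {R : realType} {A : cstarAlgType R}.
Implicit Types (a b g x y z r s c : A) (k : R[i]) (t d : R).

Lemma aboveZ t d x : 0 <= t -> above d x -> above (t * d) (t%:C%C *: x).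
Proof.
move=> t0 [xs [t' h]]; split; first by rewrite starrZ xs.
exists (t * t'); rewrite rmorphM /= -scalerA -scalerBr rnormrZ ger0_norm //.
by rewrite -mulrBr ler_wpM2l.
Qed.

(** Rescale a to 1 - x with |x| <= q < 1 and look for the square root in the form
    1 - z; then z = (x + z^2)/2, a fixed-point equation for a map contracting the
    ball of radius q.  The fixed point is unique there, hence self-adjoint. *)
Lemma sqrt_exists d a : 0 < d -> above d a ->
  exists d' s, [/\ 0 < d', above d' s & s * s = a].
Proof.
move=> d0 [as_ [t ta]].
have t0 : 0 < t by have := le_trans (rnorm_ge0 _) ta; rewrite subr_ge0; exact: lt_le_trans.
pose x : A := 1 - t^-1%:C%C *: a; pose q : R := 1 - d / t.
have xs : star x = x by rewrite starB star1 starrZ as_.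
have tC : t%:C%C *: (t^-1%:C%C *: a) = a.
  by rewrite scalerA -rmorphM /= divff ?scale1r // gt_eqF.
have xq : rnorm x <= q.
  have -> : x = t^-1%:C%C *: (t%:C%C%:A - a).
    by rewrite scalerBr scalerA -rmorphM /= mulVf ?scale1r // gt_eqF.
  rewrite rnormrZ gtr0_norm ?invr_gt0 // ler_pdivrMl //.
  by rewrite mulrBr mulr1 mulrCA divff ?mulr1 // gt_eqF.
have q0 : 0 <= q by rewrite (le_trans _ xq) ?rnorm_ge0.
have dt : 0 < d / t by rewrite divr_gt0.
have q1 : q < 1 by rewrite /q; lra.
pose f z : A := (2^-1 : R)%:C%C *: (x + z * z).
have h2 : 0 <= (2^-1 : R) by rewrite invr_ge0.
have fq y z : rnorm y <= q -> rnorm z <= q -> rnorm (f y - f z) <= q * rnorm (y - z).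
  move=> yq zq; rewrite -scalerBr rnormrZ ger0_norm // ler_pdivrMl //.
  rewrite opprD addrACA subrr add0r.
  have -> : y * y - z * z = y * (y - z) + (y - z) * z.
    by rewrite mulrBr mulrBl addrA subrK.
  rewrite mulr_natl mulr2n (le_trans (rnormD _ _)) // lerD //.
    by rewrite (le_trans (rnormM _ _)) // ler_wpM2r ?rnorm_ge0.
  by rewrite (le_trans (rnormM _ _)) // mulrC ler_wpM2r ?rnorm_ge0.
have fr z : rnorm z <= q -> rnorm (f z) <= q.
  move=> zq; rewrite rnormrZ ger0_norm // ler_pdivrMl // mulr_natl mulr2n.
  rewrite (le_trans (rnormD _ _)) // lerD // (le_trans (rnormM _ _)) //.
  by rewrite (le_trans _ zq) // ler_piMr ?rnorm_ge0 // (le_trans zq) ?ltW.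
have [|z zq zE] := contraction_fixed_point f q q _ q0 fr fq; first by rewrite q0.
have zs : star z = z.
  have : rnorm (z - star z) <= q * rnorm (z - star z).
    have {1}-> : z - star z = f z - f (star z).
      by rewrite zE; congr (_ - _); rewrite -{1}zE starrZ starD starM xs.
    by apply: fq; rewrite ?rnorm_star.
  have := rnorm_ge0 (z - star z); rewrite le_eqVlt => /orP[|n0].
    by rewrite eq_sym rnorm_eq0 subr_eq0 => /eqP.
  by rewrite ler_pMl // leNgt q1.
have y2 : (1 - z) * (1 - z) = t^-1%:C%C *: a.
  have : z + z = x + z * z.
    rewrite -{1 2}zE -scalerDl -rmorphD /= -[RHS]scale1r; congr (_ *: _).
    by congr (_%:C)%C; lra.
  rewrite mulrBr mulr1 mulrBl mul1r opprB addrACA -opprD => ->.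
  by rewrite opprD addrACA subrr addr0 subKr.
exists (Num.sqrt t * (d / t)), ((Num.sqrt t)%:C%C *: (1 - z)).
split; first by rewrite mulr_gt0 ?sqrtr_gt0.
  apply: aboveZ; first exact: sqrtr_ge0.
  split; first by rewrite starB star1 zs.
  by exists 1; rewrite rmorph1 scale1r subKr.
rewrite -scalerAl -scalerAr scalerA -rmorphM /= -expr2 sqr_sqrtr ?(ltW t0) //.
by rewrite y2.
Qed.

Lemma sylvester_le d r s y : 0 < d -> positive r -> above d s ->
  d * rnorm y <= rnorm (r * y + y * s).
Proof. by move=> d0 /positive_above0 r0 sd; rewrite -[d]add0r above_sylvester. Qed.

Lemma sqr_unit y : (y * y \is a GRing.unit) = (y \is a GRing.unit).
Proof. by rewrite unitrM_comm // andbb. Qed.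

Lemma sqrt_spec a : pos_invertibles a ->
  pos_invertibles (cstar_sqrt a) /\ cstar_sqrt a * cstar_sqrt a = a.
Proof.
move=> pa; have [d d0 da] := pos_invertibles_above _ pa.
have [d' [s [d'0 sd' ss]]] := sqrt_exists _ _ d0 da.
have [|sp e] := @xgetPex _ 0 [set y : A | positive y /\ y * y = a].
  by exists s; split => //; apply: above_positive sd'; exact: ltW.
by split=> //; split=> //; rewrite /invertibles /= -sqr_unit e; case: pa.
Qed.

Lemma pos_invertibles_sqrt a : pos_invertibles a -> pos_invertibles (cstar_sqrt a).
Proof. by move=> /sqrt_spec[]. Qed.

Lemma sqrt_sqr a : pos_invertibles a -> cstar_sqrt a * cstar_sqrt a = a.
Proof. by move=> /sqrt_spec[]. Qed.

Lemma sqrt_uniq a y : pos_invertibles a -> positive y -> y * y = a ->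
  cstar_sqrt a = y.
Proof.
move=> pa py ya; have [d d0 sd] := pos_invertibles_above _ (pos_invertibles_sqrt _ pa).
have := sylvester_le _ _ _ (y - cstar_sqrt a) d0 py sd.
rewrite mulrBr mulrBl ya sqrt_sqr // addrA subrK subrr rnorm0 pmulr_rle0 // => le0.
apply/esym/eqP; rewrite -subr_eq0 -rnorm_eq0 eq_le le0 rnorm_ge0 //.
Qed.

Lemma sqrt_lipschitz d a b : 0 < d -> above d (cstar_sqrt a) ->
  pos_invertibles a -> pos_invertibles b ->
  d * rnorm (cstar_sqrt b - cstar_sqrt a) <= rnorm (b - a).
Proof.
move=> d0 ad pa pb; have [_ pb'] := pos_invertibles_sqrt _ pb.
have := sylvester_le _ _ _ (cstar_sqrt b - cstar_sqrt a) d0 pb' ad.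
by rewrite mulrBr mulrBl !sqrt_sqr // addrA subrK.
Qed.

(** The commutator c = y s - s y of y with s = a^(1/2) satisfies
    s c + c s = y a - a y = 0, and the Sylvester bound makes it vanish. *)
Lemma sqrt_comm a y : pos_invertibles a -> y * a = a * y ->
  y * cstar_sqrt a = cstar_sqrt a * y.
Proof.
move=> pa ya; have ps := pos_invertibles_sqrt _ pa.
have [d d0 sd] := pos_invertibles_above _ ps.
set s := cstar_sqrt a in ps sd *.
have := sylvester_le _ _ _ (y * s - s * y) d0 ps.2 sd.
have -> : s * (y * s - s * y) + (y * s - s * y) * s = 0.
  rewrite mulrBr mulrBl !mulrA sqrt_sqr // -[y * s * s]mulrA sqrt_sqr // ya.
  by rewrite addrC addrA subrK subrr.
rewrite rnorm0 pmulr_rle0 // => le0.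
by apply/eqP; rewrite -subr_eq0 -rnorm_eq0 eq_le le0 rnorm_ge0.
Qed.

(** For u < 0, y^2 - u factors into y - iv and y + iv with v^2 = - u, and both
    are invertible since the spectrum of y is real. *)
Lemma square_positive y : star y = y -> positive (y * y).
Proof.
move=> ys; have yys : star (y * y) = y * y by exact: star_commM.
split=> // k kx /=; have := spectrum_sa_real _ _ yys kx.
case: k kx => u v /= + v0; rewrite {v}v0 => ux.
rewrite lecE /= eqxx /= leNgt; apply/negP => u0.
pose w : R[i] := (0 +i* Num.sqrt (- u))%C.
have su : 0 < Num.sqrt (- u) by rewrite sqrtr_gt0 oppr_gt0.
have ww : w * w = u%:C%C.
  apply/eqP; rewrite eq_complex /= !mul0r !mulr0 !addr0 sub0r eqxx andbT.
  by rewrite -expr2 sqr_sqrtr ?opprK // oppr_ge0 ltW.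
have U k : complex.Im k != 0 -> k%:A - y \is a GRing.unit.
  move=> k0; apply/negPn/negP => /(spectrum_sa_real _ _ ys) ki.
  by rewrite ki eqxx in k0.
have U1 : w%:A - y \is a GRing.unit by apply: U; rewrite /= gt_eqF.
have U2 : w%:A + y \is a GRing.unit.
  rewrite -unitrN opprD -scaleNr; apply: U.
  by rewrite /= oppr_eq0 gt_eqF.
move: ux; rewrite /spectrum /= => /negP; apply.
have -> : (u +i* 0)%C%:A - y * y = (w%:A - y) * (w%:A + y).
  rewrite mulrBl !mulrDr -!scalerAl -!scalerAr !mul1r !mulr1 scalerA ww.
  by rewrite opprD addrA addrK.
by rewrite unitrMr.
Qed.

(** If c inverts 1 - xy, then 1 + y c x inverts 1 - yx. *)
Lemma unit_one_subM x y : 1 - x * y \is a GRing.unit -> 1 - y * x \is a GRing.unit.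
Proof.
move=> u; pose c := (1 - x * y)^-1.
have c1 : c - x * y * c = 1 by rewrite -[X in X - _]mul1r -mulrBl mulrV.
have c2 : c - c * x * y = 1 by rewrite -mulrA -[X in X - _]mulr1 -mulrBr mulVr.
apply/unitrP; exists (1 + y * c * x); split.
  rewrite mulrDl mul1r mulrBr mulr1.
  have -> : y * c * x * (y * x) = y * (c * x * y) * x by rewrite !mulrA.
  by rewrite -mulrBl -mulrBr c2 mulr1 subrK.
rewrite mulrDr mulr1 mulrBl mul1r.
have -> : y * x * (y * c * x) = y * (x * y * c) * x by rewrite !mulrA.
by rewrite -mulrBl -mulrBr c1 mulr1 subrK.
Qed.

Lemma spectrumMC x y k : k != 0 -> spectrum (x * y) k -> spectrum (y * x) k.
Proof.
move=> k0; rewrite /spectrum /=; apply: contra.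
have E p q : k%:A - p * q = k *: (1 - (k^-1 *: p) * q) :> A.
  by rewrite scalerBr -scalerAl scalerA divff // scale1r.
rewrite !E !scaler_unit ?unitfE // => /unit_one_subM.
by rewrite -scalerAr scalerAl.
Qed.

(** Twice c c^* + c^* c is a sum of two squares of self-adjoint elements, so
    c^* c is positive when - c c^* is.  But c c^* and c^* c have the same nonzero
    spectrum, so the spectrum of c c^* is at once nonnegative and nonpositive,
    and its norm is 0. *)
Lemma star_mul_npos c : positive (- (c * star c)) -> c = 0.
Proof.
move=> np.
pose h := c + star c; pose l : A := 'i *: (c - star c).
have hs : star h = h by rewrite starD starK addrC.
have ls : star l = l by rewrite starZ conjCi starB starK scaleNr -scalerN opprB.
have p2 : positive ((2 : R)%:C%C *: (star c * c)).
  have -> : (2 : R)%:C%C *: (star c * c) =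
      h * h + l * l + (- (c * star c) + - (c * star c)).
    have -> : l * l = - ((c - star c) * (c - star c)).
      by rewrite -scalerAr -scalerAl scalerA -expr2 sqrCi scaleN1r.
    rewrite rmorph_nat scaler_nat mulr2n mulrBl !mulrBr mulrDl !mulrDr.
    move: (c * c) (star c * c) (c * star c) (star c * star c) => e1 e2 e3 e4.
    rewrite opprB [- (e1 - e3)]opprB [e2 - e4 + _]addrC [e1 + e3]addrC.
    rewrite [e3 + e1 + (e2 + e4) + _]addrACA [e3 + e1 + _]addrACA [e2 + e4 + _]addrACA.
    rewrite !subrr !addr0.
    by rewrite -opprD [e3 + e3 + _]addrC addrK.
  by apply: positiveD; apply: positiveD => //; exact: square_positive.
have p1 : positive (star c * c).
  have -> : star c * c = (2^-1 : R)%:C%C *: ((2 : R)%:C%C *: (star c * c)).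
    by rewrite scalerA -rmorphM /= mulVf ?scale1r.
  apply: (@above_positive _ _ (2^-1 * 0)); first by rewrite mulr0.
  by apply: aboveZ; [rewrite invr_ge0|exact: positive_above0].
have ccs : star (c * star c) = c * star c by rewrite starM starK.
have [t tE tc] := norm_in_spectrum _ ccs.
have t0 : t = 0.
  apply: contraPeq tc => t0 tc.
  have tC0 : t%:C%C != 0 by rewrite (inj_eq (@complexI _) _ 0).
  have : 0 <= t%:C%C by apply: p1.2; exact: spectrumMC tc.
  have : 0 <= (- t)%:C%C.
    apply: np.2; rewrite -[- _]add0r -[X in X - _](scale0r 1).
    by rewrite rmorphN -[X in spectrum _ X]add0r spectrum_reflect.
  rewrite !lecR oppr_ge0 => ? ?; case/eqP: t0; apply/le_anti/andP; split=> //.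
apply/eqP; rewrite -rnorm_eq0 -rnorm_star -sqrf_eq0 -rnorm_starM starK -tE t0.
by rewrite normr0.
Qed.

(** With x = g g^* and m = (x^2)^(1/2) the product c = (m - x) g satisfies
    c c^* = (m - x) x (m - x) = - (m - x) m (m - x), because x (m - x) is
    - m (m - x).  Hence c = 0, and x = m is positive. *)
Lemma mul_star_pos_invertibles g : g \is a GRing.unit ->
  pos_invertibles (g * star g).
Proof.
move=> ug; set x := g * star g.
have ux : x \is a GRing.unit by rewrite unitrMr // star_unit.
have xs : star x = x by rewrite starM starK.
have px2 : pos_invertibles (x * x).
  by split; [rewrite /invertibles /= sqr_unit|exact: square_positive].
set m := cstar_sqrt (x * x).
have pm : pos_invertibles m by exact: pos_invertibles_sqrt.
have mm : m * m = x * x by exact: sqrt_sqr.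
have xm : x * m = m * x by apply: sqrt_comm => //; rewrite mulrA.
set s := cstar_sqrt m.
have ps : pos_invertibles s by exact: pos_invertibles_sqrt.
have ss : s * s = m by exact: sqrt_sqr.
have xs' : x * s = s * x by exact: sqrt_comm.
have ms : m * s = s * m by rewrite -ss mulrA.
have ss' : star s = s by case: ps => _ [].
have ms' : star m = m by case: pm => _ [].
suff : (m - x) * g = 0.
  move=> /(congr1 (fun z => z * g^-1)); rewrite mulrK // mul0r => /eqP.
  by rewrite subr_eq0 => /eqP <-.
have ds : star (m - x) = m - x by rewrite starB ms' xs.
have dsc : (m - x) * s = s * (m - x) by rewrite mulrBl mulrBr ms xs'.
apply: star_mul_npos.
have -> : - ((m - x) * g * star ((m - x) * g)) = ((m - x) * s) * ((m - x) * s).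
  have -> : (m - x) * s * ((m - x) * s) = (m - x) * (m * (m - x)).
    by rewrite {2}dsc -!mulrA [s * (s * _)]mulrA ss.
  rewrite starM ds -!mulrA [g * (_ * _)]mulrA -mulrN; congr (_ * _).
  by rewrite !mulrBr -xm mm opprB.
by apply/square_positive/star_commM.
Qed.

End SquareRoot.

(** * Continuity of the operations *)

Section Continuity.
Context {R : realType} {A : cstarAlgType R}.
Context {T : Type} {F : set_system T} {FF : Filter F}.
Implicit Types (a b : A) (f h : T -> A).

Lemma cvg_rnorm_le f a (e : T -> R) : e @ F --> (0 : R) ->
  (\forall x \near F, rnorm (a - f x) <= e x) -> f @ F --> a.
Proof.
move=> e0 fe; apply/cvg_rnorm; apply: squeeze_cvgr (cvg_cst 0) e0.
by apply: filterS fe => x ->; rewrite rnorm_ge0.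
Qed.

Lemma cvg_mul f h a b : f @ F --> a -> h @ F --> b ->
  (fun x => f x * h x) @ F --> a * b.
Proof.
move=> /cvg_rnorm fa /cvg_rnorm hb.
pose e x := rnorm (a - f x) * rnorm b +
  (rnorm a + rnorm (a - f x)) * rnorm (b - h x).
apply: (@cvg_rnorm_le _ _ e).
  have -> : (0 : R) = 0 * rnorm b + (rnorm a + 0) * 0 by rewrite mul0r mulr0 addr0.
  by apply: cvgD; apply: cvgM => //; [exact: cvg_cst|apply: cvgD => //; exact: cvg_cst].
apply: nearW => x.
have -> : a * b - f x * h x = (a - f x) * b + f x * (b - h x).
  by rewrite mulrBl mulrBr addrA subrK.
rewrite (le_trans (rnormD _ _)) // lerD ?rnormM // (le_trans (rnormM _ _)) //.
rewrite ler_wpM2r ?rnorm_ge0 // -[f x](subKr a) (le_trans (rnormB _ _)) //.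
by rewrite subKr.
Qed.

Lemma cvg_star f a : f @ F --> a -> (fun x => star (f x)) @ F --> star a.
Proof.
move=> /cvg_rnorm fa; apply: (cvg_rnorm_le _ _ _ fa).
by apply: nearW => x; rewrite -starB rnorm_star.
Qed.

(** a^-1 - y^-1 = - a^-1 (a - y) y^-1; once |a^-1| |a - y| <= 1/2 this identity
    first bounds |y^-1| by 2 |a^-1|, and then the difference itself. *)
Lemma cvg_inverse f a : a \is a GRing.unit ->
  (\forall x \near F, f x \is a GRing.unit) ->
  f @ F --> a -> (fun x => (f x)^-1) @ F --> a^-1.
Proof.
move=> ua uf /cvg_rnorm fa; set c := rnorm a^-1.
have c0 : 0 < c.
  rewrite lt_neqAle eq_sym rnorm_eq0 rnorm_ge0 andbT.
  by apply: contraTneq ua => a0; rewrite -unitrV a0 unitr0.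
apply: (@cvg_rnorm_le _ _ (fun x => 2 * c * c * rnorm (a - f x))).
  by rewrite -[X in _ --> X](mulr0 (2 * c * c)); apply: cvgM => //; exact: cvg_cst.
have e0 : 0 < (2 * c)^-1 by rewrite invr_gt0 mulr_gt0.
move/cvgrPdist_lt : fa => /(_ _ e0) fa.
near=> x.
have ux : f x \is a GRing.unit by near: x.
have : rnorm (a - f x) < (2 * c)^-1.
  by rewrite -[ltLHS]ger0_norm ?rnorm_ge0 // -normrN -sub0r; near: x.
have E : a^-1 - (f x)^-1 = - (a^-1 * (a - f x) * (f x)^-1).
  by rewrite mulrBr mulVr // mulrBl mul1r mulrK // opprB.
set n := rnorm (a - f x); have n0 : 0 <= n by exact: rnorm_ge0.
move=> nc; have nc2 : c * n <= 2^-1.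
  rewrite -(ler_pM2l (_ : 0 < 2 :> R)) // mulrA mulfV // -ler_pdivlMl ?mulr_gt0 //.
  by rewrite mulr1 ltW.
have bnd : rnorm (a^-1 - (f x)^-1) <= c * n * rnorm (f x)^-1.
  rewrite E rnormN (le_trans (rnormM _ _)) // ler_wpM2r ?rnorm_ge0 //.
  exact: rnormM.
have : rnorm (f x)^-1 <= c + rnorm (a^-1 - (f x)^-1).
  by rewrite -{1}[(f x)^-1](subKr a^-1) (le_trans (rnormB _ _)).
move=> fx; have fx2 : rnorm (f x)^-1 <= 2 * c.
  have := ler_wpM2r (rnorm_ge0 (f x)^-1) nc2; lra.
rewrite (le_trans bnd) // [leRHS]mulrC -/n.
have := ler_wpM2l (mulr_ge0 (ltW c0) n0) fx2.
by rewrite [_ * (2 * c)]mulrC [X in _ <= X]mulrA [X in _ <= X]mulrC.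
Unshelve. all: by end_near. Qed.

Lemma cvg_sqrt f a : pos_invertibles a ->
  (\forall x \near F, pos_invertibles (f x)) ->
  f @ F --> a -> (fun x => cstar_sqrt (f x)) @ F --> cstar_sqrt a.
Proof.
move=> pa pf /cvg_rnorm fa.
have [d d0 sd] := pos_invertibles_above _ (pos_invertibles_sqrt _ pa).
apply: (@cvg_rnorm_le _ _ (fun x => d^-1 * rnorm (a - f x))).
  by rewrite -[X in _ --> X](mulr0 d^-1); apply: cvgM => //; exact: cvg_cst.
apply: filterS pf => x px; rewrite ler_pdivlMl // rnormBC [leRHS]rnormBC.
exact: sqrt_lipschitz.
Qed.

End Continuity.

(** * Polar decomposition and the unitary group of a *)

Section Polar.
Context {R : realType} {A : cstarAlgType R}.
Implicit Types (a g h s u : A).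

Lemma conj_pos_invertibles s h : pos_invertibles s -> h \is a GRing.unit ->
  pos_invertibles (h * s * star h).
Proof.
move=> ps uh; have [ur [rs _]] := pos_invertibles_sqrt _ ps.
have -> : h * s * star h = (h * cstar_sqrt s) * star (h * cstar_sqrt s).
  by rewrite starM rs -{1}(sqrt_sqr _ ps) !mulrA.
by apply: mul_star_pos_invertibles; rewrite unitrMr.
Qed.

Lemma unitary_part_unitary g : g \is a GRing.unit -> unitaries (unitary_part g).
Proof.
move=> ug; have pg := mul_star_pos_invertibles _ ug.
have [ur [rs _]] := pos_invertibles_sqrt _ pg.
have rr := sqrt_sqr _ pg; set r := cstar_sqrt _ in ur rs rr.
have uu : r^-1 * g \is a GRing.unit by rewrite unitrMr ?unitrV.
split; first exact: uu.
apply: (mulrI uu); rewrite mulrV // starM starV rs -/r.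
by rewrite mulrA -[r^-1 * g * _]mulrA -rr mulrA mulVr // mul1r mulrV.
Qed.

Lemma polar_unitaries_for a s u : a \is a GRing.unit -> pos_invertibles s ->
  unitaries u -> unitaries_for a (s * u) <-> s * a * s = u * a * u^-1.
Proof.
move=> ua [us [ss _]] [uu su]; rewrite /unitaries_for /= starM su ss invrM //.
split=> [[_ e]|e].
  have := congr1 (fun z => u * a * z * s) e.
  by rewrite mulrA !mulrA mulrK // divrr // mul1r mulrVK.
split; first by rewrite /invertibles /= unitrMr.
apply: (mulIr us); rewrite mulrVK //.
have -> : a^-1 * (u^-1 * s) * a * s = a^-1 * u^-1 * (s * a * s) by rewrite !mulrA.
rewrite e.
by rewrite !mulrA mulrVK // mulVr // mul1r.
Qed.

(** The factor s of the polar decomposition s u of the point where the fiber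
    over u meets the unitary group of a. *)
Definition twisted_modulus a u : A :=
  (cstar_sqrt a)^-1 * cstar_sqrt (cstar_sqrt a * u * a * u^-1 * cstar_sqrt a)
    * (cstar_sqrt a)^-1.

Lemma twisted_square_pos_invertibles a u : pos_invertibles a -> unitaries u ->
  pos_invertibles (cstar_sqrt a * u * a * u^-1 * cstar_sqrt a).
Proof.
move=> pa [uu su]; have [uq [qs _]] := pos_invertibles_sqrt _ pa.
have -> : cstar_sqrt a * u * a * u^-1 * cstar_sqrt a =
    (cstar_sqrt a * u) * a * star (cstar_sqrt a * u).
  by rewrite starM su qs !mulrA.
by apply: conj_pos_invertibles => //; rewrite unitrMr.
Qed.

Lemma twisted_modulus_pos_invertibles a u : pos_invertibles a -> unitaries u ->
  pos_invertibles (twisted_modulus a u).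
Proof.
move=> pa Uu; have [uq [qs _]] := pos_invertibles_sqrt _ pa.
have := pos_invertibles_sqrt _ (twisted_square_pos_invertibles _ _ pa Uu).
have uqV : (cstar_sqrt a)^-1 \is a GRing.unit by rewrite unitrV.
by move=> /(conj_pos_invertibles _ _)/(_ uqV); rewrite starV qs.
Qed.

(** Conjugating by q = a^(1/2) turns s a s into (q s q)^2, so the equation says
    that q s q is a square root of q u a u^-1 q. *)
Lemma twisted_modulusE a u s : pos_invertibles a -> unitaries u ->
  pos_invertibles s ->
  s * a * s = u * a * u^-1 <-> s = twisted_modulus a u.
Proof.
move=> pa Uu ps; have [uq [qs _]] := pos_invertibles_sqrt _ pa.
have qq := sqrt_sqr _ pa; rewrite /twisted_modulus.
have pt := twisted_square_pos_invertibles _ _ pa Uu.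
set q := cstar_sqrt a in uq qs qq pt *.
split=> [e|->].
  have pS : pos_invertibles (q * s * q) by rewrite -{2}qs; exact: conj_pos_invertibles.
  rewrite (sqrt_uniq _ _ pt pS.2); first by rewrite !mulrA mulVr // mul1r mulrK.
  have -> : q * u * a * u^-1 * q = q * (u * a * u^-1) * q by rewrite !mulrA.
  by rewrite -e -qq !mulrA.
have SS := sqrt_sqr _ pt; set S := cstar_sqrt (q * u * a * u^-1 * q) in SS *.
have -> : q^-1 * S * q^-1 * a * (q^-1 * S * q^-1) = q^-1 * (S * S) * q^-1.
  by rewrite -qq !mulrA mulrVK // mulrK.
by rewrite SS !mulrA mulVr // mul1r mulrK.
Qed.

Lemma fiber_unitaries_for a u : pos_invertibles a -> unitaries u ->
  unitary_fiber u `&` unitaries_for a = [set twisted_modulus a u * u].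
Proof.
move=> pa Uu; have [ua _] := pa; have [uu su] := Uu.
apply/seteqP; split=> g /=.
  move=> [[ug gu] gU]; have pg := mul_star_pos_invertibles _ ug.
  have ps := pos_invertibles_sqrt _ pg.
  have gE : g = cstar_sqrt (g * star g) * u.
    by rewrite -gu /unitary_part mulVKr //; case: ps.
  rewrite {1}gE; congr (_ * _); apply/(twisted_modulusE _ _ _ pa Uu ps).
  by apply/(polar_unitaries_for _ _ _ ua ps Uu); rewrite -gE.
move=> ->; have ps := twisted_modulus_pos_invertibles _ _ pa Uu.
set s := twisted_modulus a u in ps *; have [us [ss sp]] := ps.
have usu : s * u \is a GRing.unit by rewrite unitrMr.
split; last first.
  by apply/(polar_unitaries_for _ _ _ ua ps Uu)/(twisted_modulusE _ _ _ pa Uu ps).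
split=> //; rewrite /unitary_part.
rewrite (sqrt_uniq _ s) //; first by rewrite mulKr.
  exact: mul_star_pos_invertibles.
by rewrite starM su ss !mulrA mulrK.
Qed.

End Polar.

Theorem theorem3p2 (R : realType) (A : cstarAlgType R) (a : A)
    (ha : pos_invertibles a) :
  (forall u : A, unitaries u ->
     unitary_fiber u `&` unitaries_for a =
     [set (cstar_sqrt a)^-1
          * cstar_sqrt (cstar_sqrt a * u * a * u^-1 * cstar_sqrt a)
          * (cstar_sqrt a)^-1 * u]) /\
  homeomorphism_on (unitaries_for a) (unitaries : set A) unitary_part.
Proof.
have fib (u : A) : unitaries u ->
    (unitary_fiber u `&` unitaries_for a) (twisted_modulus a u * u).
  by move=> Uu; rewrite fiber_unitaries_for.
split; first by move=> u; exact: fiber_unitaries_for.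
exists (fun u => twisted_modulus a u * u); split.
- by move=> g [ug _]; exact: unitary_part_unitary.
- by move=> u /fib[].
- move=> g /set_mem [ug gU].
  have : (unitary_fiber (unitary_part g) `&` unitaries_for a) g by [].
  by rewrite fiber_unitaries_for //; exact: unitary_part_unitary.
- by move=> u /set_mem /fib[[]].
split; apply/subspace_continuousP.
  move=> g [ug _]; have id : x @[x --> within (unitaries_for a) (nbhs g)] --> g.
    exact: cvg_within.
  have nu : \forall x \near within (unitaries_for a) (nbhs g), x \is a GRing.unit.
    by apply: filterS (withinT _ _) => x [].
  apply: cvg_mul => //; apply: cvg_inverse.
  + by have /pos_invertibles_sqrt[] := mul_star_pos_invertibles _ ug.
  + by apply: filterS nu => x /mul_star_pos_invertibles/pos_invertibles_sqrt[].
  apply: cvg_sqrt; first exact: mul_star_pos_invertibles.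
    by apply: filterS nu => x /mul_star_pos_invertibles.
  by apply: cvg_mul => //; exact: cvg_star.
move=> u Uu; have id : x @[x --> within unitaries (nbhs u)] --> u.
  exact: cvg_within.
have nU : \forall x \near within unitaries (nbhs u), unitaries x.
  exact: withinT.
apply: cvg_mul => //; apply: cvg_mul; last exact: cvg_cst.
apply: cvg_mul; first exact: cvg_cst.
apply: cvg_sqrt; first exact: twisted_square_pos_invertibles.
  by apply: filterS nU => x; exact: twisted_square_pos_invertibles.
apply: cvg_mul; last exact: cvg_cst.
apply: cvg_mul.
  by apply: cvg_mul; [apply: cvg_mul => //|]; exact: cvg_cst.
apply: cvg_inverse => //; first by case: Uu.
by apply: filterS nU => x [].
Qed.
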